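(* Let $m\in\mathbb{N}$ and $\lambda>0$. The moments $\big(M_n^{(m)}(\lambda)\big)_{n}$, where $M_0^{(m)}(\lambda)=1$ and $M_n^{(m)}(\lambda)=\sum_{q=1}^n\lambda^q|NC_n(q,m)|$ for $n\in\mathbb{N}$, determine a unique measure on the real line, and it is of the form $$\mu_\lambda^{(m)}=\sum_{k=0}^m a_{m,k}(\lambda)\,\delta_{y_{m,k}(\lambda)},$$ where $$y_{m,0}(\lambda)=0,\qquad y_{m,k}(\lambda)=2\sqrt\lambda\cos\left(\frac{k\pi}{m+1}\right)+\lambda+1,\quad k=1,\ldots,m,$$ $$a_{m,0}(\lambda)=\sqrt\lambda\,\frac{U_{m+1}\left(\frac{\lambda+1}{2\sqrt\lambda}\right)}{U_m\left(\frac{\lambda+1}{2\sqrt\lambda}\right)}-\lambda,\qquad a_{m,k}(\lambda)=\frac{2\lambda\sin^2\left(\frac{k\pi}{m+1}\right)}{(m+1)\left[2\sqrt\lambda\cos\left(\frac{k\pi}{m+1}\right)+\lambda+1\right]},\quad k=1,\ldots,m.$$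
   Context: $\mathbb{N}=\{1,2,\ldots\}$; $\delta_x$ is the Dirac measure at $x$. $U_m$ denotes the Chebyshev polynomial of the second kind, $U_m(\cos\theta)=\sin((m+1)\theta)/\sin\theta$, i.e. $U_0(x)=1$, $U_1(x)=2x$, $U_{m+1}(x)=2xU_m(x)-U_{m-1}(x)$. A partition of $\{1,\ldots,n\}$ is non-crossing if there are no $i<j<i'<j'$ with $i,i'$ in one block and $j,j'$ in a different block. The depth of a non-crossing partition is the maximal $d$ for which there are blocks $B_1,\ldots,B_d$ with $\min B_i<\min B_{i+1}\le\max B_{i+1}<\max B_i$ for $1\le i<d$. $|NC_n(q,m)|$ is the number of non-crossing partitions of $\{1,\ldots,n\}$ with $q$ blocks and depth at most $m$. *)

(* Defs.v *)
From mathcomp Require Import all_boot all_order all_algebra.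

Set Implicit Arguments.
Unset Strict Implicit.
Unset Printing Implicit Defensive.

(** The set {1, ..., n} is represented by ['I_n] = {0, ..., n-1}: the notions
    below only involve the order on it. *)

Section NonCrossing.
Variable n : nat.
Implicit Types (B C : {set 'I_n}) (P : {set {set 'I_n}}).

Definition crossing B C : bool :=
  [exists i : 'I_n, exists j : 'I_n, exists i' : 'I_n, exists j' : 'I_n,
    [&& i < j, j < i', i' < j', i \in B, i' \in B, j \in C & j' \in C]].

Definition noncrossing P : bool :=
  [forall B in P, forall C in P, (B != C) ==> ~~ crossing B C].

(* The default values [n] and [0] are only reached on the empty set, which is
   never a block of a partition. *)
Definition bmin B : nat := \big[minn/n]_(i in B) (i : nat).
Definition bmax B : nat := \max_(i in B) (i : nat).

Definition nested B C : bool := (bmin B < bmin C <= bmax C) && (bmax C < bmax B).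

Definition nested_chain P (s : seq {set 'I_n}) : bool :=
  all (mem P) s && sorted nested s.

(* Only the lengths [d <= #|P|] need to be searched, see [nested_chain_depth]. *)
Definition depth P : nat :=
  \max_(d < #|P|.+1 | [exists s : d.-tuple {set 'I_n}, nested_chain P s]) d.

Lemma nested_chain_depth P (s : seq {set 'I_n}) :
  nested_chain P s -> size s <= depth P.
Proof.
move=> /andP[/allP sP ss].
have nt : transitive nested.
  move=> B A C /andP[/andP[h1 _] h2] /andP[/andP[h3 h4] h5]; apply/andP; split.
    by rewrite (ltn_trans h1 h3).
  exact: ltn_trans h5 h2.
have ni : irreflexive nested by move=> B; rewrite /nested !ltnn.
have us := sorted_uniq nt ni ss.
have sz : size s < #|P|.+1.
  by rewrite ltnS cardE uniq_leq_size // => B /sP; rewrite mem_enum.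
apply: (@leq_bigmax_cond _ _ _ (Ordinal sz)); apply/existsP.
by exists (in_tuple s); rewrite /nested_chain ss andbT; apply/allP.
Qed.

Definition NC (q m : nat) : {set {set {set 'I_n}}} :=
  [set P : {set {set 'I_n}} |
    [&& partition P [set: 'I_n], noncrossing P, #|P| == q & depth P <= m]].

End NonCrossing.

From mathcomp Require Import all_classical all_reals all_analysis.

Import Order.TTheory GRing.Theory Num.Theory.

Local Open Scope ring_scope.

Fixpoint chebyshevU (R : pzRingType) (m : nat) (x : R) : R :=
  match m with
  | 0 => 1
  | S p => if p is S r then 2 * x * chebyshevU p x - chebyshevU r x else 2 * x
  end.

Lemma chebyshevU_cos (R : realType) (m : nat) (t : R) :
  chebyshevU m (cos t) * sin t = sin (m.+1%:R * t).
Proof.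
elim/ltn_ind: m => -[|[|r]] IH.
- by rewrite /= !mul1r.
- by rewrite mulr_natl sin_mulr2n mulr2n [LHS]/= mulr_natl mulr2n mulrDl.
rewrite [chebyshevU _ _]/= mulrBl -mulrA (IH r.+1) // (IH r) //.
set a := r.+2%:R * t.
have -> : r.+1%:R * t = a - t by rewrite /a -[r.+2%:R]natr1 mulrDl mul1r addrK.
have -> : r.+3%:R * t = a + t by rewrite /a -[r.+3%:R]natr1 mulrDl mul1r.
rewrite sinB sinD -mulrA mulr_natl mulr2n [cos t * _]mulrC.
by rewrite opprB addrACA subrr addr0 addrC.
Qed.

Section Atoms.
Variables (R : realType) (m : nat) (lam : R).

Definition NC_moment (n : nat) : R :=
  if n is 0 then 1 else \sum_(1 <= q < n.+1) lam ^+ q * #|NC n q m|%:R.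

Definition angle (k : nat) : R := k%:R * pi / m.+1%:R.

Definition atom (k : nat) : R :=
  if k is 0 then 0 else 2 * Num.sqrt lam * cos (angle k) + lam + 1.

Definition weight (k : nat) : R :=
  if k is 0 then
    let x := (lam + 1) / (2 * Num.sqrt lam) in
    Num.sqrt lam * (chebyshevU m.+1 x / chebyshevU m x) - lam
  else
    2 * lam * sin (angle k) ^+ 2 /
      (m.+1%:R * (2 * Num.sqrt lam * cos (angle k) + lam + 1)).

End Atoms.

Definition has_moments (R : realType)
    (mu : {measure set (measurableTypeR R) -> \bar R}) (M : nat -> R) : Prop :=
  forall n : nat,
    mu.-integrable [set: R] (fun x : R => (x ^+ n)%:E) /\
    (\int[mu]_(x in [set: R]) (x ^+ n)%:E = (M n)%:E)%E.

(* Main.v *)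
(** Let W(a,b,m) be the sum of lam^|P| over the non-crossing partitions P of
    {a, ..., b-1} of depth at most m.  If the block of a is not {a}, let c be
    the next element of that block: the blocks inside (a,c) form a partition of
    depth at most m-1, and the remaining blocks, with a removed, a partition of
    {c, ..., b-1} of depth at most m.  Hence
      W(a,b,m) = lam W(a+1,b,m) + sum_(a<c<b) W(a+1,c,m-1) W(c,b,m),
    so that W(a,b,m) = lam s_m(b-a-1) for a < b, where
      s_(m+1)(n+1) = (1+lam) s_(m+1)(n) + lam sum_(i<n) s_m(i) s_(m+1)(n-1-i).
    The moments s_m(n) = sum_k b_k y_k^n of the Gauss quadrature at the zeros
    y_k of the rescaled Chebyshev polynomial U_m satisfy the same recurrence:
    the divided differences of x^n expand the convolution into sums
    sum_k b_k / (x - y_k), which are quotients of consecutive orthogonal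
    polynomials by the Christoffel-Darboux formula and the discrete
    orthogonality of the sines.  At x = 0 the same identity gives the mass of
    the atom 0.  A measure with the moments of a measure supported on a finite
    set S integrates prod_(y in S) (x-y)^2 to 0, so it lives on S too, and its
    values are read off from interpolation polynomials. *)

Require Import Defs.
From mathcomp Require Import all_boot all_order all_algebra.
From mathcomp Require Import zify ring lra.

Set Implicit Arguments.
Unset Strict Implicit.
Unset Printing Implicit Defensive.

(** * Non-crossing partitions of an interval *)

Section Blocks.
Variable n : nat.
Implicit Types (B C D X : {set 'I_n}) (P Q : {set {set 'I_n}}).

Lemma bmin_le B (y : 'I_n) : y \in B -> bmin B <= y.
Proof.
move=> yB; rewrite /bmin; elim: (index_enum _) (mem_index_enum y) => // x s IH.
rewrite inE big_cons => /predU1P[<-|/IH le_y]; first by rewrite yB geq_minl.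
by case: ifP => // _; rewrite geq_min le_y orbT.
Qed.

Lemma bmin_lt B C : B != set0 -> C != set0 ->
  (bmin B < bmin C) <-> exists2 x, x \in B & {in C, forall y : 'I_n, x < y}.
Proof.
(* The bound [k <= n] is forced by the start value [n] of the minimum in [bmin]. *)
have leq_bmin D k : k <= n -> (k <= bmin D) <-> {in D, forall y : 'I_n, k <= y}.
  move=> kn; split=> [h y yD|h].
    exact: leq_trans h (bmin_le yD).
  by rewrite /bmin; elim/big_ind: _ => [//|u v hu hv|]; [lia | exact: h].
move=> /set0Pn[b0 b0B] /set0Pn[c0 c0C]; split=> [h|[x xB h]].
  case: (boolP [exists x in B, (x : nat) <= bmin B])
      => [/exists_inP[x xB xm]|/exists_inPn H].
    exists x => // y yC; apply: leq_ltn_trans xm _; exact: leq_trans h (bmin_le yC).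
  suff: bmin B < bmin B by rewrite ltnn.
  rewrite [X in _ < X]/bmin; apply/leq_bmin => [|x xB]; last by rewrite ltnNge H.
  by rewrite (leq_trans h) // (leq_trans (bmin_le c0C)) // ltnW.
apply: (@leq_trans x.+1).
  by rewrite ltnS bmin_le.
by apply/leq_bmin.
Qed.

Lemma bmax_lt B C : B != set0 -> C != set0 ->
  (bmax C < bmax B) <-> exists2 x, x \in B & {in C, forall y : 'I_n, y < x}.
Proof.
move=> /set0Pn[b0 b0B] /set0Pn[c0 c0C]; split=> [h|[x xB h]].
  have [x xB xm] : {x : 'I_n | x \in B & bmax B = x}.
    by apply: eq_bigmax_cond; rewrite card_gt0; apply/set0Pn; exists b0.
  exists x => // y yC; rewrite -xm; apply: leq_ltn_trans h.
  exact: (@leq_bigmax_cond _ (mem C)).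
apply: (@leq_trans x); last exact: (@leq_bigmax_cond _ (mem B)).
have [y yC ->] : {y : 'I_n | y \in C & bmax C = y}.
  by apply: eq_bigmax_cond; rewrite card_gt0; apply/set0Pn; exists c0.
exact: h.
Qed.

Lemma nestedP B C : B != set0 -> C != set0 ->
  nested B C <-> (exists2 x, x \in B & {in C, forall y : 'I_n, x < y}) /\
                 (exists2 x, x \in B & {in C, forall y : 'I_n, y < x}).
Proof.
move=> B0 C0; rewrite -bmin_lt // -bmax_lt // /nested.
suff -> : bmin C <= bmax C by rewrite andbT; split=> /andP.
case/set0Pn: C0 => c cC; apply: (@leq_trans c).
  exact: bmin_le.
exact: (@leq_bigmax_cond _ (mem C)).
Qed.

(* Rank functions, unlike chains, are easily glued and restricted. *)
Lemma depth_leP P m :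
  depth P <= m <-> exists f : {set 'I_n} -> nat,
    {in P, forall B, f B < m} /\ {in P &, forall B C, nested B C -> f B < f C}.
Proof.
have chain Q : exists2 s, nested_chain Q s & size s = depth Q.
  rewrite /depth.
  case: (@eq_bigmax_cond _ (fun d : 'I_#|Q|.+1 =>
      [exists s : d.-tuple {set 'I_n}, nested_chain Q s]) (fun d => d : nat)).
    by apply/card_gt0P; exists ord0; apply/existsP; exists [tuple].
  by move=> d /existsP[s hs] ->; exists (tval s); rewrite ?size_tuple.
split=> [dm|[f [fm fn]]]; last first.
  have [s /andP[/allP sP' ss] <-] := chain P.
  have {sP'} sP : {subset s <= P} by [].
  (* Ranks increase strictly along a chain, so its last block has rank at least the length minus
     one. *)
  have lt B t : path (@nested n) B t -> {subset B :: t <= P} -> size t <= f (last B t).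
    elim/last_ind: t => // t y IH; rewrite rcons_path last_rcons size_rcons.
    move=> /andP[pt nty] sub; have subt : {subset B :: t <= P}.
      by move=> z zt; apply: sub; rewrite -rcons_cons mem_rcons inE zt orbT.
    apply: leq_ltn_trans (IH pt subt) _; apply: fn nty; first exact/subt/mem_last.
    by rewrite sub // -rcons_cons mem_rcons mem_head.
  case: s => // B s in sP ss *.
  by apply: leq_ltn_trans (lt _ _ ss sP) (fm _ _); apply/sP/mem_last.
have nt : transitive (@nested n).
  move=> B A C /andP[/andP[h1 _] h2] /andP[/andP[h3 h4] h5]; apply/andP; split.
    by rewrite (ltn_trans h1 h3).
  exact: ltn_trans h5 h2.
(* All blocks of [Q] surround [B], so a longest chain in [Q] can be continued by [B]. *)
have lt B Q Q' : B \in Q' -> {in Q, forall X, X \in Q' /\ nested X B} ->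
    depth Q < depth Q'.
  move=> BQ' sub; have [s /andP[/allP sQ' ss] <-] := chain Q.
  have {sQ'} sQ : {subset s <= Q} by [].
  rewrite -(size_rcons s B); apply: nested_chain_depth; apply/andP; split.
    by rewrite all_rcons /= BQ'; apply/allP => X /sQ /sub[].
  case: s => // X s in sQ ss *; rewrite rcons_cons /= rcons_path; apply/andP; split=> //.
  by have /sQ/sub[] := mem_last X s.
(* The rank of a block is the length of a longest chain of blocks strictly around it. *)
exists (fun B => depth [set X in P | nested X B]); split=> [B BP|B C BP CP nBC].
  by apply: leq_trans dm; apply: (lt B) => // X; rewrite inE => /andP[].
apply: (lt B); first by rewrite inE BP.
move=> X; rewrite inE => /andP[XP XB]; rewrite inE XP; split=> //; exact: nt XB nBC.
Qed.

Lemma blocksP P D : reflect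
  [/\ {in P, forall B, B != set0 /\ B \subset D},
      {in D, forall x, exists2 B, B \in P & x \in B} &
      {in P &, forall B C, forall x, x \in B -> x \in C -> B = C}]
  (partition P D).
Proof.
apply: (iffP and3P) => [[/eqP cv /trivIsetP tr n0]|[H1 H2 H3]].
  split=> [B BP|x|B C BP CP x xB xC].
  - split; first by apply: contraNneq n0 => <-.
    by rewrite -cv; exact: bigcup_sup.
  - by rewrite -cv => /bigcupP[B]; exists B.
  - apply: contraTeq xC => BC; have /disjoint_setI0/setP/(_ x) := tr _ _ BP CP BC.
    by rewrite !inE xB => /negbT.
split.
- apply/eqP/setP=> x; apply/bigcupP/idP => [[B BP xB]|/H2[B]]; last by exists B.
  by have [_ /subsetP->] := H1 B BP.
- apply/trivIsetP=> B C BP CP; apply: contraNT => /pred0Pn[x /andP[xB xC]].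
  by apply/eqP; exact: H3 xB xC.
- by apply/negP=> /H1[]; rewrite eqxx.
Qed.

Lemma noncrossingP P : reflect
  {in P &, forall B C, forall i j i' j' : 'I_n, i < j -> j < i' -> i' < j' ->
     i \in B -> i' \in B -> j \in C -> j' \in C -> B = C}
  (noncrossing P).
Proof.
apply: (iffP forall_inP) => [H B C BP CP i j i' j' h1 h2 h3 h4 h5 h6 h7|H B BP].
  apply: contraTeq isT => BC.
  have /forall_inP/(_ C CP)/implyP/(_ BC)/existsPn/(_ i)/existsPn/(_ j) := H B BP.
  by move=> /existsPn/(_ i')/existsPn/(_ j'); rewrite h1 h2 h3 h4 h5 h6 h7.
apply/forall_inP=> C CP; apply/implyP; apply: contraNN.
move=> /existsP[i /existsP[j /existsP[i' /existsP[j']]]].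
by case/and5P=> h1 h2 h3 h4 /and3P[h5 h6 h7]; apply/eqP/(H _ _ BP CP i j i' j').
Qed.

End Blocks.

(* [lia] is slow in the large contexts below, hence the [clear]. *)
Local Ltac ord_lia := repeat match goal with
  | H : is_true (leq _ _) |- _ => move: H
  | H : is_true (leq _ _ && leq _ _) |- _ => move: H
  end; clear; lia.

(** * Cutting and gluing at the successor of the first point *)

Section Glue.
Variable n : nat.
Implicit Types (x y z : 'I_n) (B C D : {set 'I_n}) (P : {set {set 'I_n}}).

Definition NCon m D : {set {set {set 'I_n}}} :=
  [set P : {set {set 'I_n}} | [&& partition P D, noncrossing P & depth P <= m]].

Definition segment (a b : nat) : {set 'I_n} := [set i : 'I_n | a <= i < b].

(* For [a < c]: [c] is the successor of [a] in its block.  Also true if [c = a]. *)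
Definition follows (a c : 'I_n) P : bool :=
  [exists A in P, [&& a \in A, c \in A & A :&: segment a.+1 c == set0]].

Definition extend (a c : 'I_n) B := if c \in B then a |: B else B.

(** [Q.1] is meant as a partition of the gap between [a] and [c], [Q.2] as one of an interval that
    starts at [c]. *)
Definition glue (a c : 'I_n) (Q : {set {set 'I_n}} * {set {set 'I_n}}) :=
  Q.1 :|: [set extend a c B | B in Q.2].

Definition unglue (a c : 'I_n) P :=
  ([set B in P | B \subset segment a.+1 c],
   [set B :\ a | B in P & ~~ (B \subset segment a.+1 c)]).

Lemma in_segment a b x : (x \in segment a b) = (a <= x < b).
Proof. by rewrite inE. Qed.

Lemma in_extend a c B x : (x \in extend a c B) = (x \in B) || (x == a) && (c \in B).
Proof.
rewrite /extend; case: ifP => cB; rewrite ?inE ?andbT ?andbF ?orbF //.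
by rewrite orbC.
Qed.

Lemma extend_neq0 a c B : B != set0 -> extend a c B != set0.
Proof.
by case/set0Pn=> x xB; apply/set0Pn; exists x; rewrite in_extend xB.
Qed.

(** Extending the block of [c] down to [a] puts it around the blocks of [Q1] and creates no nesting
    among those of [Q2]. So [Q1] gains one level and [Q2] none. *)
Lemma glue_NC m (a c : 'I_n) (b : nat) Q1 Q2 : a < c -> c < b ->
  Q1 \in NCon m (segment a.+1 c) -> Q2 \in NCon m.+1 (segment c b) ->
  [/\ glue a c (Q1, Q2) \in NCon m.+1 (segment a b), follows a c (glue a c (Q1, Q2)),
      unglue a c (glue a c (Q1, Q2)) = (Q1, Q2) &
      #|glue a c (Q1, Q2)| = #|Q1| + #|Q2| ].
Proof.
move=> ac cb; rewrite !inE.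
move=> /and3P[/blocksP[H1 H2 H3] /noncrossingP H4 /depth_leP[f1 [f1m f1n]]].
move=> /and3P[/blocksP[K1 K2 K3] /noncrossingP K4 /depth_leP[f2 [f2m f2n]]].
have Hlt B x : B \in Q1 -> x \in B -> a < x < c.
  by move=> /H1[_ /subsetP h] /h; rewrite in_segment.
have Klt B x : B \in Q2 -> x \in B -> c <= x < b.
  by move=> /K1[_ /subsetP h] /h; rewrite in_segment.
have KE B x : B \in Q2 -> x \in extend a c B -> c <= x < b /\ x \in B \/ x = a /\ c \in B.
  move=> BQ; rewrite in_extend => /orP[xB|/andP[/eqP -> cB]]; last by right.
  by left; split=> //; exact: Klt xB.
have aB B : B \in Q2 -> a \notin B.
  by move=> BQ; apply/negP => /(Klt B a BQ); ord_lia.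
have extK : {in Q2, cancel (extend a c) (fun B => B :\ a)}.
  move=> B BQ; apply/setP => x; rewrite !inE in_extend.
  case: eqP => [->|_]; first by rewrite (negbTE (aB _ BQ)).
  by rewrite orbF.
have notsub B : B \in Q2 -> ~~ (extend a c B \subset segment a.+1 c).
  move=> BQ; have [/set0Pn[x xB] _] := K1 B BQ.
  apply/negP => /subsetP/(_ x); rewrite in_extend xB in_segment => /(_ isT).
  by have := Klt _ _ BQ xB; ord_lia.
have [B0 B0Q cB0] : exists2 B, B \in Q2 & c \in B by apply: K2; rewrite in_segment; ord_lia.
have Q12 B : B \in Q1 -> B \in [set extend a c B | B in Q2] -> False.
  move=> BQ /imsetP[C CQ eB]; have := notsub C CQ; rewrite -eB; move/negP; apply.
  by have [] := H1 B BQ.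
have dis : [disjoint Q1 & [set extend a c B | B in Q2]].
  by apply/pred0P => B /=; apply/negP => /andP[]; exact: Q12.
split.
- apply/and3P; split.
  + apply/blocksP; split.
    * move=> B /setUP[BQ|/imsetP[C CQ ->]].
        have [h _] := H1 B BQ; split=> //; apply/subsetP=> x xB; rewrite in_segment.
        by have := Hlt _ _ BQ xB; ord_lia.
      have [h _] := K1 C CQ; split; first exact: extend_neq0.
      apply/subsetP=> x /(KE _ _ CQ); rewrite in_segment => -[[]|[->]]; ord_lia.
    * move=> x; rewrite in_segment => xab.
      have [xa|xa] := eqVneq x a.
        exists (extend a c B0); first by rewrite inE; apply/orP; right; exact: imset_f.
        by rewrite in_extend xa eqxx cB0 orbT.
      have {xa} xa : a < x by move: xa; rewrite -val_eqE /=; ord_lia.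
      have [xc|xc] := ltnP x c.
        have [|B BQ xB] := H2 x; first by rewrite in_segment; ord_lia.
        by exists B => //; rewrite inE BQ.
      have [|B BQ xB] := K2 x; first by rewrite in_segment; ord_lia.
      exists (extend a c B); first by rewrite inE; apply/orP; right; exact: imset_f.
      by rewrite in_extend xB.
    * move=> B C /setUP[BQ|/imsetP[B' BQ ->]] /setUP[CQ|/imsetP[C' CQ ->]] x.
      - exact: H3.
      - move=> /(Hlt _ _ BQ) h1 /(KE _ _ CQ) h2; exfalso.
        by case: h2 => [[]|[h2 _]]; last rewrite h2 in h1; ord_lia.
      - move=> /(KE _ _ BQ) h2 /(Hlt _ _ CQ) h1; exfalso.
        by case: h2 => [[]|[h2 _]]; last rewrite h2 in h1; ord_lia.
      - move=> /(KE _ _ BQ) h2 /(KE _ _ CQ) h1; congr (extend a c _).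
        case: h1 => [[h1 xC]|[h1 cC]]; case: h2 => [[h2 xB]|[h2 cB]].
        + exact: K3 xB xC.
        + by rewrite h2 in h1; ord_lia.
        + by rewrite h1 in h2; ord_lia.
        + exact: K3 cB cC.
  + apply/noncrossingP => B C + + i j i' j' ij ji ij'.
    move=> /setUP[BQ|/imsetP[B' BQ ->]] /setUP[CQ|/imsetP[C' CQ ->]].
    * exact: H4 ij ji ij'.
    * move=> /(Hlt _ _ BQ) h1 /(Hlt _ _ BQ) h2 /(KE _ _ CQ) h3 _.
      by exfalso; case: h3 => [[]|[h3 _]]; last rewrite h3 in ij; ord_lia.
    * move=> _ /(KE _ _ BQ) h3 /(Hlt _ _ CQ) h1 /(Hlt _ _ CQ) h2.
      by exfalso; case: h3 => [[]|[h3 _]]; last rewrite h3 in ji; ord_lia.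
    * move=> /(KE _ _ BQ) h1 /(KE _ _ BQ) h2 /(KE _ _ CQ) h3 /(KE _ _ CQ) h4.
      congr (extend a c _).
      case: h2 => [[h2 iB']|[h2 _]]; last first.
        exfalso; rewrite h2 in ji ij'.
        by case: h3 => [[]|[h3 _]]; last rewrite h3 in ji; ord_lia.
      case: h4 => [[h4 jC']|[h4 _]]; last by exfalso; rewrite h4 in ij'; ord_lia.
      case: h3 => [[h3 jC]|[h3 _]]; last first.
        exfalso; rewrite h3 in ij.
        by case: h1 => [[]|[h1 _]]; last rewrite h1 in ij; ord_lia.
      (* A crossing that starts at [a] can start at [c] instead, unless [j] is [c]; then both blocks
         contain [c]. *)
      case: h1 => [[h1 iB]|[h1 cB]].
        exact: K4 BQ CQ _ _ _ _ ij ji ij' iB iB' jC jC'.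
      have [jc|jc] := eqVneq j c; first by rewrite jc in jC; exact: K3 cB jC.
      apply: (K4 B' C' BQ CQ c j i' j') => //.
      by move: jc; rewrite -val_eqE /=; ord_lia.
  + apply/depth_leP.
    (* Blocks of [Q1] go one level deeper. The block of [a] gets rank 0, as it contains the leftmost
       point and nothing surrounds it. *)
    exists (fun X => if X \in Q1 then (f1 X).+1 else if a \in X then 0 else f2 X).
    have nQ1 B : B \in Q2 -> (extend a c B \in Q1) = false.
      by move=> BQ; apply/negP => /Q12; apply; exact: imset_f.
    have ext0 B : B \in Q2 -> a \notin extend a c B -> extend a c B = B.
      by rewrite /extend; case: ifP => // _ _; rewrite !inE eqxx.
    split=> [B /setUP[BQ|/imsetP[B' BQ ->]]|
             B C /setUP[BQ|/imsetP[B' BQ ->]] /setUP[CQ|/imsetP[C' CQ ->]]].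
    * by rewrite BQ ltnS f1m.
    * by rewrite nQ1 //; case: ifPn => // /ext0 ->; rewrite // f2m.
    * by rewrite BQ CQ ltnS; exact: f1n.
    * move=> /nestedP[||_ [z zB zC]].
      - by have [] := H1 B BQ.
      - by apply: extend_neq0; have [] := K1 C' CQ.
      have [/set0Pn[y yC] _] := K1 C' CQ.
      have := Klt _ _ CQ yC; have := Hlt _ _ BQ zB.
      have := zC y; rewrite in_extend yC => /(_ isT); ord_lia.
    * rewrite nQ1 // CQ; case: ifPn => // /ext0 -> //.
      move=> /nestedP[||[x xB xC] _]; [by case: (K1 B' BQ)|by case: (H1 C CQ)|].
      have [/set0Pn[y yC] _] := H1 C CQ.
      have := Klt _ _ BQ xB; have := Hlt _ _ CQ yC; have := xC y yC; ord_lia.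
    * rewrite !nQ1 //; have [aC|aC] := boolP (a \in extend a c C').
        move=> /nestedP[||[x xB xC] _].
        - by apply: extend_neq0; case: (K1 B' BQ).
        - by apply: extend_neq0; case: (K1 C' CQ).
        have := xC a aC; case: (KE _ _ BQ xB) => [[]|[-> _]]; ord_lia.
      have cC : c \notin C' by move: aC; rewrite in_extend eqxx negb_or => /andP[].
      rewrite [extend a c C']ext0 //.
      have [aB'|aB'] := boolP (a \in extend a c B'); last by rewrite ext0 //; exact: f2n.
      have cB : c \in B' by move: aB'; rewrite in_extend (negbTE (aB _ BQ)) eqxx.
      move=> /nestedP[||_ [z zB zC]].
      - by apply: extend_neq0; case: (K1 B' BQ).
      - by case: (K1 C' CQ).
      (* The block of [c] surrounds [C'] even without [a], so [f2] is positive at [C']. *)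
      apply: leq_ltn_trans (leq0n _) (f2n _ _ BQ CQ _).
      have [nB' _] := K1 B' BQ; have [nC' _] := K1 C' CQ.
      apply/nestedP=> //; split.
        exists c => // y yC; have := Klt _ _ CQ yC.
        have : y != c by apply: contraNneq cC => <-.
        by rewrite -val_eqE /=; ord_lia.
      exists z => //; case: (KE _ _ BQ zB) => [[]//|[za _]].
      have /set0Pn[y yC] := nC'; have := zC _ yC; have := Klt _ _ CQ yC.
      by rewrite za; ord_lia.
- apply/exists_inP; exists (extend a c B0).
    by rewrite inE; apply/orP; right; exact: imset_f.
  rewrite !in_extend eqxx cB0 orbT /=; apply/eqP/setP => x; rewrite !inE.
  by apply/negP => /andP[/(KE _ _ B0Q)[[]|[->]]]; ord_lia.
- congr pair; apply/setP => B.
    rewrite inE; apply/andP/idP => [[/setUP[//|/imsetP[C CQ ->]]]|BQ].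
      by rewrite (negbTE (notsub _ CQ)).
    by split; [rewrite inE BQ|have [] := H1 B BQ].
  apply/imsetP/idP => [[C]|BQ].
    rewrite inE => /andP[/setUP[CQ|/imsetP[C' CQ ->]]].
      by have [_ ->] := H1 C CQ.
    by move=> _ ->; rewrite extK.
  exists (extend a c B); last by rewrite extK.
  by rewrite inE notsub // andbT inE; apply/orP; right; exact: imset_f.
- rewrite cardsU disjoint_setI0 // cards0 subn0; congr (_ + _).
  by rewrite card_in_imset //; exact: can_in_inj extK.
Qed.

(** Every block other than the block [A] of [a] and [c] lies either in the gap or to the right of
    [c]. Those in the gap are surrounded by [A], so on their own they have one level less. *)
Lemma unglue_NC m (a c : 'I_n) (b : nat) P : a < c -> c < b ->
  P \in NCon m.+1 (segment a b) -> follows a c P ->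
  [/\ (unglue a c P).1 \in NCon m (segment a.+1 c),
      (unglue a c P).2 \in NCon m.+1 (segment c b) & glue a c (unglue a c P) = P].
Proof.
move=> ac cb; rewrite !inE.
move=> /and3P[/blocksP[H1 H2 H3] /noncrossingP H4 /depth_leP[f [fm fn]]].
move=> /exists_inP[A AP /and3P[aA cA /eqP/setP Ac]].
have Hlt B x : B \in P -> x \in B -> a <= x < b.
  by move=> /H1[_ /subsetP h] /h; rewrite in_segment.
have Adis x : x \in A -> x = a \/ c <= x.
  move=> xA; have := Ac x; rewrite !inE xA /= => h.
  have [->|] := eqVneq x a; first by left.
  by rewrite -val_eqE /= => xa; right; have := Hlt _ _ AP xA; move: xa h; ord_lia.
(* A block with points on both sides of [c] would cross [A] at [a] and [c]. *)
have dich B : B \in P -> B != A ->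
    {in B, forall x, a < x} /\ (B \subset segment a.+1 c \/ {in B, forall x, c < x}).
  move=> BP BA.
  have BAd x : x \in B -> x \notin A.
    by move=> xB; apply: contraNN BA => xA; apply/eqP; exact: H3 xB xA.
  have aB x : x \in B -> a < x.
    move=> xB; have := Hlt _ _ BP xB.
    have : x != a by apply: contraTneq aA => <-; exact: BAd.
    by rewrite -val_eqE /=; ord_lia.
  split=> //; case: (boolP (B \subset _)) => [|/subsetPn[y yB y0]]; [by left|right => x xB].
  have cNB z : z \in B -> z != c by move=> zB; apply: contraTneq cA => <-; exact: BAd.
  have cy : c < y.
    move: y0; rewrite in_segment; have := aB _ yB; have := cNB _ yB.
    by rewrite -val_eqE /=; ord_lia.
  rewrite ltnNge; apply/negP => xc; have {}xc : x < c.
    by move: (cNB _ xB); rewrite -val_eqE /=; ord_lia.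
  by case/eqP: BA; apply/esym; exact: (H4 A B AP BP a x c y (aB _ xB)).
have AnS : ~~ (A \subset segment a.+1 c).
  by apply/subsetPn; exists a; rewrite // in_segment; ord_lia.
have in2 B : B \in P -> ~~ (B \subset segment a.+1 c) ->
    B :\ a != set0 /\ {in B :\ a, forall x, c <= x}.
  move=> BP BnS; have [->|BA] := eqVneq B A.
    split; first by apply/set0Pn; exists c; rewrite !inE cA -val_eqE /=; ord_lia.
    by move=> x; rewrite !inE => /andP[xa /Adis[xa'|//]]; rewrite xa' eqxx in xa.
  have [aB [|cB]] := dich B BP BA; first by rewrite (negbTE BnS).
  split; last by move=> x; rewrite !inE => /andP[_ /cB]; ord_lia.
  have [/set0Pn[x xB] _] := H1 B BP; apply/set0Pn; exists x.
  by rewrite !inE xB -val_eqE /=; have := aB _ xB; ord_lia.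
have extK B : B \in P -> ~~ (B \subset segment a.+1 c) -> extend a c (B :\ a) = B.
  move=> BP BnS; have [->|BA] := eqVneq B A.
    by rewrite /extend !inE cA -val_eqE /= (gtn_eqF ac) /= setD1K.
  have [aB [|cB]] := dich B BP BA; first by rewrite (negbTE BnS).
  have BaB : B :\ a = B.
    apply/setP=> x; rewrite !inE -val_eqE /=.
    case: (boolP (x \in B)) => [/aB|]; last by rewrite andbF.
    by ord_lia.
  by rewrite BaB /extend; case: ifP => // /cB; rewrite ltnn.
split.
- apply/and3P; split.
  + apply/blocksP; split.
    * by move=> B; rewrite inE => /andP[BP BS]; have [] := H1 B BP.
    * move=> x; rewrite in_segment => xac.
      have [|B BP xB] := H2 x; first by rewrite in_segment; ord_lia.
      exists B => //; rewrite inE BP /=.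
      have [BA|BA] := eqVneq B A.
        by exfalso; rewrite BA in xB; case: (Adis _ xB) xac => [->|]; ord_lia.
      by have [_ [//|cB]] := dich B BP BA; have := cB _ xB; move: xac; ord_lia.
    * by move=> B C; rewrite !inE => /andP[BP _] /andP[CP _]; exact: H3.
  + by apply/noncrossingP=> B C; rewrite !inE => /andP[BP _] /andP[CP _]; exact: H4.
  (* The predecessor preserves strict inequalities here: ranks in the gap are positive because of
     [A]. *)
  + apply/depth_leP; exists (fun B => (f B).-1).
    have fpos B : B \in P -> B \subset segment a.+1 c -> 0 < f B.
      move=> BP BS; apply: leq_ltn_trans (leq0n _) (fn _ _ AP BP _).
      have [B0 _] := H1 B BP.
      apply/nestedP => //; first by apply/set0Pn; exists a.
      by split; [exists a|exists c] => // y /(subsetP BS); rewrite in_segment; ord_lia.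
    split=> [B|B C]; rewrite !inE => /andP[BP BS].
      by have := fm _ BP; have := fpos _ BP BS; ord_lia.
    move=> /andP[CP CS] /(fn _ _ BP CP).
    by have := fpos _ BP BS; have := fpos _ CP CS; ord_lia.
- have in2P B : B \in (unglue a c P).2 ->
      exists2 B', B' \in P /\ ~~ (B' \subset segment a.+1 c) & B = B' :\ a.
    by move=> /imsetP[B']; rewrite inE => /andP[? ?] ->; exists B'.
  apply/and3P; split.
  + apply/blocksP; split.
    * move=> B /in2P[B' [BP BnS] ->]; have [nB cB] := in2 B' BP BnS; split=> //.
      apply/subsetP => x xB; rewrite in_segment cB //.
      by move: xB; rewrite !inE => /andP[_ /(Hlt _ _ BP)]; ord_lia.
    * move=> x; rewrite in_segment => xcb.
      have [|B BP xB] := H2 x; first by rewrite in_segment; ord_lia.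
      exists (B :\ a); last by rewrite !inE xB -val_eqE /=; ord_lia.
      apply/imsetP; exists B => //; rewrite inE BP /=; apply/subsetPn; exists x => //.
      by rewrite in_segment; ord_lia.
    * move=> B C /in2P[B' [BP BnS] ->] /in2P[C' [CP CnS] ->] x.
      by rewrite !inE => /andP[_ xB] /andP[_ xC]; congr (_ :\ _); exact: H3 xB xC.
  + apply/noncrossingP => B C /in2P[B' [BP BnS] ->] /in2P[C' [CP CnS] ->] i j i' j' h1 h2 h3.
    rewrite !inE => /andP[_ k1] /andP[_ k2] /andP[_ k3] /andP[_ k4]; congr (_ :\ _).
    exact: (H4 _ _ BP CP i j i' j').
  + apply/depth_leP; exists (fun B => f (extend a c B)).
    split=> [B /in2P[B' [BP BnS] ->]|]; first by rewrite extK ?fm.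
    move=> B C /in2P[B' [BP BnS] ->] /in2P[C' [CP CnS] ->]; rewrite !extK //.
    have [nB _] := in2 _ BP BnS; have [nC _] := in2 _ CP CnS.
    move=> /nestedP[]// [x xB xC] [z zB zC]; apply: fn => //.
    have [[nB' _] [nC' _]] := (H1 _ BP, H1 _ CP).
    (* The inner block cannot be [A]: without [a] it still contains [c], the leftmost remaining
       point, so nothing surrounds it. *)
    have aC : C' :\ a = C'.
      apply/setP=> y; rewrite !inE; case: eqP => // ->; apply/esym/negP => aC'.
      have CA : C' = A by exact: H3 aC' aA.
      have [_ cB] := in2 _ BP BnS.
      have := xC c; rewrite CA !inE cA andbT -val_eqE /= (gtn_eqF ac) => /(_ isT).
      by have := cB _ xB; ord_lia.
    rewrite aC in xC zC; move: xB zB; rewrite !inE => /andP[_ xB] /andP[_ zB].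
    by apply/nestedP => //; split; [exists x|exists z].
- apply/setP=> B; apply/setUP/idP => [[|/imsetP[B' /imsetP[B2]]]|BP].
  + by rewrite inE => /andP[].
  + by rewrite inE => /andP[BP BnS] -> ->; rewrite extK.
  + have [BS|BnS] := boolP (B \subset segment a.+1 c); first by left; rewrite inE BP.
    right; apply/imsetP; exists (B :\ a); last by rewrite extK.
    by apply/imsetP; exists B => //; rewrite inE BP.
Qed.

End Glue.

Lemma reindex_bij (V : nmodType) (I J : finType) (A : pred I) (B : pred J)
    (h : J -> I) (h' : I -> J) (F : I -> V) :
  (forall i, A i -> B (h' i) /\ h (h' i) = i) ->
  (forall j, B j -> A (h j) /\ h' (h j) = j) ->
  (\sum_(i | A i) F i = \sum_(j | B j) F (h j))%R.
Proof.
move=> HA HB; rewrite (reindex_onto h h') => [|i /HA[] //].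
apply: eq_bigl => j; apply/andP/idP => [[/HA[Bj _] /eqP hK]|/HB[hj hK]].
  by rewrite hK in Bj.
by rewrite hj hK eqxx.
Qed.

(** * The recurrence for the sums over non-crossing partitions *)

Section Recurrence.
Variable n : nat.
Implicit Types (x y z : 'I_n) (B C D : {set 'I_n}) (P : {set {set 'I_n}}).

(** The witness is the least point beyond [a] in the block of [a]. Stated with [pred1], uniqueness
    collapses a sum over [c] to one term. *)
Lemma follows_unique m (a : 'I_n) (b : nat) P : P \in NCon m (segment n a b) ->
  a < b -> [set a] \notin P ->
  exists c : 'I_n, (fun c' : 'I_n => [&& a < c', c' < b & follows a c' P]) =1 pred1 c.
Proof.
rewrite inE => /and3P[/blocksP[H1 H2 H3] _ _] ab naP.
have [|A AP aA] := H2 a; first by rewrite in_segment; ord_lia.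
have Aab x : x \in A -> a <= x < b.
  by have [_ /subsetP h] := H1 A AP; move/h; rewrite in_segment.
have [c0 c0A] : exists c : 'I_n, (c \in A) && (a < c).
  apply/existsP; apply: contraNT naP => /existsPn h.
  suff -> : [set a] = A by [].
  apply/setP => x; rewrite inE; apply/eqP/idP => [->//|xA].
  have := h x; rewrite xA /= -leqNgt => xa.
  by apply/val_inj => /=; move: (Aab x xA) xa; ord_lia.
case: (@arg_minnP _ c0 (fun c => (c \in A) && (a < c)) (fun c => c : nat) c0A)
  => c /andP[cA ac] cmin.
exists c => c'; apply/and3P/eqP => [[ac' cb' /exists_inP[A' A'P]]|->].
  move=> /and3P[aA' cA' /eqP/setP Ac']; have AA' := H3 _ _ AP A'P a aA aA'.
  subst A'; have := Ac' c; rewrite !inE cA /=; have := cmin c'; rewrite cA' ac' => /(_ isT).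
  by move=> h1 h2; apply/val_inj => /=; move: h1 h2; ord_lia.
split; first by []; first by have := Aab c cA; ord_lia.
apply/exists_inP; exists A => //; rewrite aA cA /=; apply/eqP/setP => x; rewrite !inE.
apply/negP => /andP[xA xc]; have := cmin x; rewrite xA /=; move: xc; ord_lia.
Qed.

(** A singleton at the left end neither surrounds nor is surrounded, so it adds no level. The bound
    is a successor because the singleton alone already has depth 1. *)
Lemma singleton_NC m (a : 'I_n) (b : nat) P :
  a < b -> P \in NCon m.+1 (segment n a.+1 b) ->
  [/\ [set a] |: P \in NCon m.+1 (segment n a b), ([set a] |: P) :\ [set a] = P &
      #|[set a] |: P| = #|P|.+1].
Proof.
move=> ab; rewrite !inE.
move=> /and3P[/blocksP[H1 H2 H3] /noncrossingP H4 /depth_leP[f [fm fn]]].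
have Hlt B x : B \in P -> x \in B -> a < x < b.
  by move=> /H1[_ /subsetP h] /h; rewrite in_segment.
have aP : [set a] \notin P.
  by apply/negP => /Hlt/(_ (set11 a)); ord_lia.
split; [|exact: setU1K|by rewrite cardsU1 aP].
have Sa : [set a] != set0 by apply/set0Pn; exists a; exact: set11.
apply/and3P; split.
- apply/blocksP; split.
  + move=> B /setU1P[->|BP].
      by split=> //; rewrite sub1set in_segment; ord_lia.
    have [h _] := H1 B BP; split=> //; apply/subsetP => x /(Hlt _ _ BP).
    by rewrite in_segment; ord_lia.
  + move=> x; rewrite in_segment => xab; have [->|xa] := eqVneq x a.
      by exists [set a]; [exact: setU11|exact: set11].
    have [|B BP xB] := H2 x; first by move: xa; rewrite in_segment -val_eqE /=; ord_lia.
    by exists B => //; rewrite setU1r.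
  + move=> B C /setU1P[->|BP] /setU1P[->|CP] x //.
    * by move=> /set1P-> /(Hlt _ _ CP); ord_lia.
    * by move=> /(Hlt _ _ BP) + /set1P xa; rewrite xa; ord_lia.
    * exact: H3.
- apply/noncrossingP => B C /setU1P[->|BP] /setU1P[->|CP] i j i' j' ij ji ij' //.
  + by move=> /set1P iE /set1P i'E; move: ij ji; rewrite iE i'E; ord_lia.
  + by move=> _ _ /set1P jE /set1P j'E; move: ji ij'; rewrite jE j'E; ord_lia.
  + exact: (H4 _ _ BP CP i j i' j').
- apply/depth_leP; exists (fun B => if B == [set a] then 0 else f B); split.
    by move=> B /setU1P[->|BP]; [rewrite eqxx|case: eqP => // _; exact: fm].
  move=> B C /setU1P[->|BP] /setU1P[->|CP] //.
  + by rewrite /nested !ltnn.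
  + have [nC _] := H1 C CP; move=> /nestedP[]// _ [x /set1P-> xC].
    by have [/set0Pn[y yC] _] := H1 C CP; have := xC y yC; have := Hlt _ _ CP yC; ord_lia.
  + have [nB _] := H1 B BP; move=> /nestedP[]// [x xB /(_ a)]; rewrite set11 => /(_ isT).
    by have := Hlt _ _ BP xB; ord_lia.
  + have nE D : D \in P -> (D == [set a]) = false.
      by move=> DP; apply: contraNF aP => /eqP <-.
    by rewrite !nE //; exact: fn.
Qed.

Lemma unsingleton_NC m (a : 'I_n) (b : nat) P :
  P \in NCon m (segment n a b) -> [set a] \in P ->
  P :\ [set a] \in NCon m (segment n a.+1 b).
Proof.
rewrite !inE => /and3P[/blocksP[H1 H2 H3] /noncrossingP H4 /depth_leP[f [fm fn]]] aP.
have naB B : B \in P -> B != [set a] -> a \notin B.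
  move=> BP; apply: contraNN => aB; apply/eqP; exact: H3 aB (set11 a).
apply/and3P; split.
- apply/blocksP; split.
  + move=> B; rewrite !inE => /andP[Ba BP]; have [h /subsetP hs] := H1 B BP; split=> //.
    apply/subsetP => x xB; have := hs x xB; rewrite !in_segment.
    have : x != a by apply: contraTneq xB => ->; exact: naB.
    by rewrite -val_eqE /=; ord_lia.
  + move=> x; rewrite in_segment => xab.
    have [|B BP xB] := H2 x; first by rewrite in_segment; ord_lia.
    exists B => //; rewrite !inE BP andbT; apply: contraTneq xB => ->.
    by rewrite inE -val_eqE /=; ord_lia.
  + by move=> B C /setD1P[_ BP] /setD1P[_ CP]; exact: H3.
- by apply/noncrossingP => B C /setD1P[_ BP] /setD1P[_ CP]; exact: H4.
- apply/depth_leP; exists f; split=> [B /setD1P[_ BP]|B C /setD1P[_ BP] /setD1P[_ CP]].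
    exact: fm.
  exact: fn.
Qed.

Import GRing.Theory.
Local Open Scope ring_scope.

Variables (R : comNzRingType) (lam : R).

(** This is W(a,b,m), taken inside a fixed ['I_n] so that subintervals need no relabelling. *)
Definition NCsum m a b := \sum_(P in NCon m (segment n a b)) lam ^+ #|P|.

Lemma NCsum_rec m (a : 'I_n) (b : nat) : (a < b)%N ->
  NCsum m.+1 a b = lam * NCsum m.+1 a.+1 b +
    \sum_(c < n | (a < c < b)%N) NCsum m a.+1 c * NCsum m.+1 c b.
Proof.
move=> ab; rewrite {1}/NCsum (bigID (fun P => [set a] \in P)) /=; congr (_ + _).
  rewrite (@reindex_bij _ _ _ _ (mem (NCon m.+1 (segment n a.+1 b)))
    (fun P => [set a] |: P) (fun P => P :\ [set a])).
  - rewrite /NCsum big_distrr /=; apply: eq_bigr => P /(singleton_NC ab)[_ _ ->].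
    by rewrite exprS.
  - by move=> P /andP[h1 h2]; rewrite [mem _ _]unsingleton_NC // setD1K.
  - by move=> P /(singleton_NC ab)[h1 h2 h3]; rewrite h1 setU11.
(* Each remaining partition is counted once, at the successor [c] of [a]. After exchanging the sums,
   [unglue] is a bijection for each fixed [c]. *)
transitivity (\sum_(P | (P \in NCon m.+1 (segment n a b)) && ([set a] \notin P))
    \sum_(c < n | [&& a < c, c < b & follows a c P]%N) lam ^+ #|P|).
  apply: eq_bigr => P /andP[hP aP]; have [c hc] := follows_unique hP ab aP.
  by rewrite (big_pred1 c).
rewrite (exchange_big_dep (fun c : 'I_n => (a < c < b)%N)) /=; last first.
  by move=> P c _ /and3P[-> ->].
apply: eq_bigr => c /andP[ac cb].
transitivity (\sum_(Q | (Q.1 \in NCon m (segment n a.+1 c)) &&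
    (Q.2 \in NCon m.+1 (segment n c b))) lam ^+ #|glue a c Q|); last first.
  rewrite /NCsum big_distrlr pair_big /=; apply: eq_bigr => -[Q1 Q2] /andP[h1 h2].
  by have [_ _ _ ->] := glue_NC ac cb h1 h2; rewrite exprD.
apply: reindex_bij (unglue a c) _ _ _ => [P|[Q1 Q2] /andP[h1 h2]].
  case/andP=> /andP[hP aP] /and3P[_ _ fP].
  by have [-> -> ->] := unglue_NC ac cb hP fP.
have [-> fP -> _] := glue_NC ac cb h1 h2; rewrite ac cb fP /=; split=> //.
rewrite andbT; apply/negP => aP; case/exists_inP: fP => A AP /and3P[aA cA _].
have [] := glue_NC ac cb h1 h2; rewrite inE => /and3P[/blocksP[_ _ H3] _ _] _ _ _.
have := H3 _ _ AP aP a aA (set11 a) => AE; move: cA; rewrite AE inE -val_eqE /=; lia.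
Qed.

Lemma NCsum_empty m a : NCsum m a a = 1.
Proof.
have it0 : segment n a a = set0 by apply/setP => x; rewrite !inE; ord_lia.
rewrite /NCsum it0 (big_pred1 set0) ?cards0 ?expr0 // => P.
rewrite inE /=; apply/and3P/eqP => [[/blocksP[H1 _ _] _ _]|->].
  apply/eqP; rewrite -subset0; apply/subsetP => B /H1[].
  by rewrite subset0 => /negbTE ->.
split.
- by apply/blocksP; split=> [B|x|B C]; rewrite inE.
- by apply/noncrossingP => B C; rewrite inE.
- by apply/depth_leP; exists (fun=> 0)%N; split=> [B|B C]; rewrite inE.
Qed.

Lemma NCsum_depth0 (a : 'I_n) b : (a < b)%N -> NCsum 0 a b = 0.
Proof.
move=> ab; rewrite /NCsum big_pred0 // => P; rewrite inE.
apply/negP => /and3P[/blocksP[_ H2 _] _ /depth_leP[f [fm _]]].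
have [|B BP _] := H2 a; first by rewrite in_segment; ord_lia.
by have := fm B BP; rewrite ltn0.
Qed.

End Recurrence.

Import Order.TTheory GRing.Theory Num.Theory.
Local Open Scope ring_scope.

(** Sorting by the number of blocks loses nothing: this number is at least 1 since [n] is positive,
    and at most [n] since blocks are nonempty. *)
Lemma NCsum_card (R : comNzRingType) (lam : R) (n m : nat) : (0 < n)%N ->
  \sum_(1 <= q < n.+1) lam ^+ q * #|NC n q m|%:R = NCsum n lam m 0 n.
Proof.
move=> n0; have sT : segment n 0 n = [set: 'I_n].
  by apply/setP => x; rewrite !inE ltn_ord.
rewrite /NCsum sT.
have cardP P : P \in NCon m [set: 'I_n] -> (0 < #|P| < n.+1)%N.
  rewrite inE => /and3P[hP _ _]; have /blocksP[H1 H2 _] := hP.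
  apply/andP; split.
    by apply/card_gt0P; have [|B BP _] := H2 (Ordinal n0); [|exists B].
  rewrite ltnS; have := card_partition hP.
  rewrite cardsT card_ord => /esym/eq_leq; apply: leq_trans; rewrite -[leqLHS]sum1_card.
  by apply: leq_sum => B /H1[h _]; rewrite card_gt0.
transitivity (\sum_(P in NCon m [set: 'I_n])
    \sum_(1 <= q < n.+1 | q == #|P|) lam ^+ q); last first.
  by apply: eq_bigr => P /cardP h; rewrite big_nat1_eq h.
rewrite (exchange_big_dep predT) //=; apply: eq_bigr => q _.
rewrite mulr_natr -sumr_const; apply: eq_bigl => P.
by rewrite !inE !andbA [in RHS]andbAC eq_sym.
Qed.

(* The shape of the moments: the moment generating function of order [m] is
   [1 + lam z S(z)] for the generating function [S] of [s m]. *)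
Definition NC_of_seq (R : comNzRingType) (lam : R) (s : nat -> nat -> R) m d :=
  if d is k.+1 then lam * s m k else 1.

(** Induction on the length of the interval, since [NCsum_rec] only involves shorter ones. It also
    yields that [NCsum] depends on [b - a] only. *)
Lemma NCsum_eq (R : comNzRingType) (lam : R) (s : nat -> nat -> R) :
  (forall k, s 0 k = 0) -> (forall m, s m.+1 0 = 1) ->
  (forall m k, s m.+1 k.+1 = (1 + lam) * s m.+1 k +
     lam * \sum_(i < k) s m i * s m.+1 (k - i.+1)%N) ->
  forall n m a b, (a <= b <= n)%N -> NCsum n lam m a b = NC_of_seq lam s m (b - a)%N.
Proof.
move=> s0 s1 s2 n m a b; move: {2}(b - a)%N (leqnn (b - a)) => d.
elim: d m a b => [|d IH] m a b bad /andP[ab bn].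
  have -> : b = a by lia.
  by rewrite subnn NCsum_empty.
have [->|nab] := eqVneq a b; first by rewrite subnn NCsum_empty.
have {nab}ab : (a < b)%N by lia.
have an : (a < n)%N by lia.
case: m => [|m].
  rewrite (@NCsum_depth0 _ _ _ (Ordinal an)) //.
  have -> : (b - a = (b - a.+1).+1)%N by lia.
  by rewrite /= s0 mulr0.
rewrite (@NCsum_rec _ _ _ m (Ordinal an)) //= IH; try lia.
(* The new index [i] is the length [c - a.+1] of the gap. *)
have -> : \sum_(c < n | (a < c < b)%N) NCsum n lam m a.+1 c * NCsum n lam m.+1 c b
  = \sum_(i < b - a.+1) NC_of_seq lam s m i * NC_of_seq lam s m.+1 (b - a.+1 - i)%N.
  transitivity (\sum_(0 <= c < n | (a < c < b)%N)
     NC_of_seq lam s m (c - a.+1)%N * NC_of_seq lam s m.+1 (b - c)%N).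
    rewrite big_mkord; apply: eq_bigr => c /andP[h1 h2].
    by rewrite !IH //; lia.
  rewrite -(big_nat_widen _ _ _ (fun c => a < c)%N) //.
  rewrite -(big_nat_widenl a.+1 _ _ predT) // -{1}[a.+1]add0n big_addn big_mkord.
  by apply: eq_bigr => i _; rewrite addnK [(i + _)%N]addnC subnDA.
have -> : (b - a = (b - a.+1).+1)%N by lia.
case: (b - a.+1)%N => [|k]; first by rewrite big_ord0 /= s1; ring.
(* The term of the empty gap has left factor 1. Together with the singleton term it produces the
   coefficient [1 + lam]. *)
rewrite big_ord_recl /= s2 mul1r.
under eq_bigr => i _.
  have -> : (k.+1 - bump 0 i = (k - i.+1).+1)%N
    by rewrite /bump leq0n; have := ltn_ord i; lia.
  over.
rewrite /= !mulrDr !mulr_sumr addrA; congr (_ + _); first by ring.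
by apply: eq_bigr => i _; ring.
Qed.

(** * Christoffel-Darboux and partial fractions *)

Section Gauss.
Variables (R : fieldType) (lam : R).

(* [orthopoly j x = sqrt lam ^ (j - 1) * U_(j-1) ((x - 1 - lam) / (2 sqrt lam))];
   the shift makes [orthopoly 0 = 0] available. *)
Fixpoint orthopoly (j : nat) (x : R) : R :=
  match j with
  | 0 => 0
  | S p => if p is S q then (x - 1 - lam) * orthopoly p x - lam * orthopoly q x
           else 1
  end.

Arguments orthopoly : simpl never.

Lemma orthopoly0 x : orthopoly 0 x = 0. Proof. by []. Qed.

Lemma orthopoly1 x : orthopoly 1 x = 1. Proof. by []. Qed.

Lemma orthopolySS j x :
  orthopoly j.+2 x = (x - 1 - lam) * orthopoly j.+1 x - lam * orthopoly j x.
Proof. by []. Qed.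

(** The powers of [lam] appear because the polynomials are monic, not orthonormal: [orthopoly j.+1]
    has squared norm [lam ^+ j]. Clearing denominators gives the exponents [m - j.+1]. *)
Lemma christoffel_darboux m x y :
  (x - y) * (\sum_(j < m) lam ^+ (m - j.+1) * orthopoly j.+1 x * orthopoly j.+1 y) =
  orthopoly m.+1 x * orthopoly m y - orthopoly m x * orthopoly m.+1 y.
Proof.
elim: m => [|m IH]; first by rewrite big_ord0 !orthopoly0; ring.
rewrite big_ord_recr /= subnn expr0 mul1r.
have -> : \sum_(j < m) lam ^+ (m.+1 - j.+1) * orthopoly j.+1 x * orthopoly j.+1 y =
   lam * \sum_(j < m) lam ^+ (m - j.+1) * orthopoly j.+1 x * orthopoly j.+1 y.
  rewrite mulr_sumr; apply: eq_bigr => j _.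
  by rewrite subSn ?exprS ?mulrA //; exact: ltn_ord.
rewrite mulrDr mulrCA IH !orthopolySS; ring.
Qed.

(** Two consecutive zeros would propagate down the recurrence to [orthopoly 1], which is 1. *)
Lemma orthopoly_coprime m x : lam != 0 ->
  orthopoly m x = 0 -> orthopoly m.+1 x != 0.
Proof.
move=> l0; elim: m => [|m IH] um; first by rewrite orthopoly1 oner_neq0.
rewrite orthopolySS um mulr0 sub0r oppr_eq0 mulf_neq0 //.
by apply/eqP => /IH; rewrite um eqxx.
Qed.

(** At a root [y k], Christoffel-Darboux expands [1 / (x - y k)] in the products
    [orthopoly j.+1 (y k) * orthopoly m (y k)]. Summed against [b], only the top term [j = m.-1]
    survives by orthogonality. *)
Lemma partial_fraction m (y b : 'I_m -> R) x : lam != 0 ->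
  (forall k, orthopoly m.+1 (y k) = 0) ->
  (forall k, orthopoly m (y k) ^+ 2 = lam ^+ m.-1) ->
  (forall j, (j < m)%N ->
     \sum_(k < m) b k * orthopoly j.+1 (y k) * orthopoly m (y k) =
     (j == m.-1)%:R * lam ^+ m.-1) ->
  orthopoly m.+1 x != 0 ->
  \sum_(k < m) b k / (x - y k) = orthopoly m x / orthopoly m.+1 x.
Proof.
case: m y b => [|m] y b l0 yroot um ortho ux.
  by rewrite big_ord0 orthopoly0 mul0r.
have uk0 k : orthopoly m.+1 (y k) != 0.
  apply/eqP => e; have := um k; rewrite e expr0n => /esym/eqP.
  by rewrite expf_eq0 (negbTE l0) andbF.
have xy k : x - y k != 0.
  by rewrite subr_eq0; apply: contraNneq ux => ->; rewrite yroot.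
have inv k : b k / (x - y k) =
    (\sum_(j < m.+1) lam ^+ (m.+1 - j.+1) * orthopoly j.+1 x *
    (b k * orthopoly j.+1 (y k) * orthopoly m.+1 (y k))) / (lam ^+ m * orthopoly m.+2 x).
  have := christoffel_darboux m.+1 x (y k); rewrite yroot mulr0 subr0.
  have -> : \sum_(j < m.+1) lam ^+ (m.+1 - j.+1) * orthopoly j.+1 x *
      (b k * orthopoly j.+1 (y k) * orthopoly m.+1 (y k)) =
      b k * orthopoly m.+1 (y k) * \sum_(j < m.+1) lam ^+ (m.+1 - j.+1) *
      orthopoly j.+1 x * orthopoly j.+1 (y k).
    by rewrite mulr_sumr; apply: eq_bigr => j _; ring.
  move: (\sum_(_ < _) _) => K; move: (um k) (uk0 k) (xy k) ux => /=.
  move: (orthopoly m.+1 (y k)) (orthopoly m.+2 x) (x - y k) => v w z <- v0 z0 w0 e.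
  have -> : K = w * v / z by rewrite -e; field.
  by field; rewrite z0 v0 w0.
rewrite (eq_bigr _ (fun k _ => inv k)) -mulr_suml exchange_big /=.
under eq_bigr => j _ do rewrite -mulr_sumr ortho ?ltn_ord //.
rewrite (bigD1 ord_max) //= eqxx subnn big1 => [|j jm].
  by rewrite (_ : true%:R = 1) //; field; rewrite ux expf_neq0.
have -> : (j == m :> nat) = false by apply/negbTE; move: jm; rewrite -val_eqE.
by rewrite mul0r mulr0.
Qed.

(* [y m] and [b m] are the nodes and weights of the quadrature of order [m]. *)
Variables (y b : forall m, 'I_m -> R).

Definition quad m n : R := \sum_(k < m) b k * y k ^+ n.

(** Each divided difference is split into two fractions, and each is summed first over the node that
    occurs only in its denominator. This leaves the quotients of [pf], evaluated at nodes of the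
    neighbouring order. *)
Lemma quad_rec m n : lam != 0 ->
  (forall m k, orthopoly m.+1 (@y m k) = 0) ->
  (forall m x, orthopoly m.+1 x != 0 ->
    \sum_(k < m) b k / (x - y k) = orthopoly m x / orthopoly m.+1 x) ->
  quad m.+1 n.+1 = (1 + lam) * quad m.+1 n +
     lam * \sum_(i < n) quad m i * quad m.+1 (n - i.+1)%N.
Proof.
move=> l0 yroot pf.
have dist (k : 'I_m) (l : 'I_m.+1) : y k != y l.
  apply/eqP => e; have := orthopoly_coprime l0 (yroot m k).
  by rewrite e yroot eqxx.
have -> : \sum_(i < n) quad m i * quad m.+1 (n - i.+1)%N =
   \sum_(k < m) \sum_(l < m.+1) b k * b l * ((y k ^+ n - y l ^+ n) / (y k - y l)).
  under eq_bigr => i _ do rewrite /quad big_distrlr /=.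
  rewrite exchange_big /=; apply: eq_bigr => k _.
  rewrite exchange_big /=; apply: eq_bigr => l _.
  have -> : (y k ^+ n - y l ^+ n) / (y k - y l) =
      \sum_(i < n) y l ^+ (n.-1 - i) * y k ^+ i.
    by rewrite -opprB subrXX -mulNr opprB mulrAC divff ?subr_eq0 // mul1r.
  rewrite mulr_sumr; apply: eq_bigr => i _.
  have -> : (n - i.+1 = n.-1 - i)%N by have := ltn_ord i; lia.
  by ring.
have -> : \sum_(k < m) \sum_(l < m.+1) b k * b l * ((y k ^+ n - y l ^+ n) / (y k - y l)) =
  \sum_(k < m) b k * y k ^+ n * (\sum_(l < m.+1) b l / (y k - y l)) +
  \sum_(l < m.+1) b l * y l ^+ n * (\sum_(k < m) b k / (y l - y k)).
  under [X in _ = _ + X]eq_bigr do rewrite mulr_sumr.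
  rewrite [X in _ = _ + X]exchange_big -big_split /=; apply: eq_bigr => k _.
  rewrite mulr_sumr -big_split; apply: eq_bigr => l _ /=.
  have d1 : y k - y l != 0 by rewrite subr_eq0.
  have d2 : y l - y k != 0 by rewrite subr_eq0 eq_sym.
  by field; rewrite d1 d2.
(* [y k] is a zero of the numerator of the quotient given by [pf]. *)
rewrite big1 ?add0r => [|k _]; last first.
  by rewrite pf ?yroot ?mul0r ?mulr0 //; exact: orthopoly_coprime.
rewrite /quad !mulr_sumr -big_split; apply: eq_bigr => l _ /=.
have ul : orthopoly m.+1 (y l) != 0.
  by apply/eqP => /(orthopoly_coprime l0); rewrite yroot eqxx.
(* At a zero of [orthopoly m.+2] the recurrence gives the quotient the value
   [(y l - 1 - lam) / lam]. Being linear in [y l], it supplies the moment of order [n.+1]. *)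
rewrite pf //; have := yroot m.+1 l; rewrite orthopolySS exprS.
move: (orthopoly m.+1 (y l)) (orthopoly m (y l)) ul => u v u0 e.
have -> : v = (y l - 1 - lam) * u / lam.
  by apply/(mulfI l0); rewrite -[LHS]add0r -e; field.
by field; rewrite l0 u0.
Qed.

End Gauss.

From mathcomp Require Import all_classical all_reals all_analysis.
From mathcomp Require Import measurable_realfun.

(** * Nodes and weights *)

Section Nodes.
Variable R : realType.

Lemma cos_nat_pi d : cos (d%:R * pi) = (-1) ^+ d :> R.
Proof.
elim: d => [|d IH]; first by rewrite mul0r cos0.
by rewrite -natr1 mulrDl mul1r cosDpi IH exprS mulN1r.
Qed.

Lemma sin_nat_pi d : sin (d%:R * pi) = 0 :> R.
Proof.
elim: d => [|d IH]; first by rewrite mul0r sin0.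
by rewrite -natr1 mulrDl mul1r sinDpi IH oppr0.
Qed.

Lemma angle_bounds m (k : nat) : (0 < k <= m)%N -> 0 < angle R m k < pi.
Proof.
move=> km; rewrite /angle divr_gt0 ?mulr_gt0 ?pi_gt0 ?ltr0n //=; last by lia.
rewrite ltr_pdivrMr ?ltr0n // mulrC ltr_pM2l ?pi_gt0 // ltr_nat; lia.
Qed.

(** With [beta] half the step of the arguments, multiplication by [2 * sin beta] makes the sum
    telescope. The range of [d] puts [beta] strictly between 0 and [pi], so this factor is
    nonzero. *)
Lemma sum_cos m d : (0 < d < m.+1.*2)%N ->
  \sum_(k < m) cos (d%:R * angle R m k.+1) = - (1 + (-1) ^+ d) / 2.
Proof.
move=> dm; set beta : R := d%:R * pi / (2 * m.+1%:R).
have sb : sin beta != 0.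
  rewrite gt_eqF // sin_gt0_pi //; apply/andP; split.
    rewrite divr_gt0 ?mulr_gt0 ?pi_gt0 ?ltr0n //; lia.
  rewrite ltr_pdivrMr ?mulr_gt0 ?ltr0n // mulrC ltr_pM2l ?pi_gt0 //.
  rewrite -natrM ltr_nat; lia.
have tele n : 2 * sin beta * \sum_(k < n) cos (d%:R * angle R m k.+1) =
    sin ((n.*2.+1)%:R * beta) - sin beta.
  elim: n => [|n IH]; first by rewrite big_ord0 mulr0 mul1r subrr.
  rewrite big_ord_recr mulrDr IH /=.
  have -> : d%:R * angle R m n.+1 = (n.+1.*2)%:R * beta.
    rewrite /angle /beta -[(n.+1).*2]muln2 natrM; field.
    by rewrite nat1r pnatr_eq0.
  have -> : n.+1.*2.+1%:R * beta = n.+1.*2%:R * beta + beta by rewrite -natr1; ring.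
  have -> : n.*2.+1%:R * beta = n.+1.*2%:R * beta - beta.
    by rewrite doubleS -[n.*2.+2%:R]natr1; ring.
  by rewrite sinB sinD; ring.
apply: (@mulfI _ (2 * sin beta)); first by rewrite mulf_neq0 ?pnatr_eq0.
rewrite tele; have -> : m.*2.+1%:R * beta = d%:R * pi - beta.
  rewrite /beta -[m.*2]muln2 -natr1 natrM -[m.+1%:R]natr1; field.
  by rewrite natr1 pnatr_eq0.
by rewrite sinB cos_nat_pi sin_nat_pi; field.
Qed.

(** Products of sines become cosine sums at [j - l] and [j + l]. For [j != l], [sum_cos] depends
    only on parity, which is the same for both, so they cancel. *)
Lemma sin_orthogonal m j l : (0 < j <= m)%N -> (0 < l <= m)%N ->
  \sum_(k < m) sin (j%:R * angle R m k.+1) * sin (l%:R * angle R m k.+1) =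
  (j == l)%:R * (m.+1%:R / 2).
Proof.
wlog lj : j l / (l <= j)%N.
  move=> H hj hl; case: (leqP l j) => [h|/ltnW h]; first exact: H.
  by rewrite eq_sym -H //; apply: eq_bigr => k _; rewrite mulrC.
move=> hj hl.
transitivity ((\sum_(k < m) cos ((j - l)%N%:R * angle R m k.+1) -
               \sum_(k < m) cos ((j + l)%N%:R * angle R m k.+1)) / 2).
  rewrite -sumrB mulr_suml; apply: eq_bigr => k _.
  rewrite natrB // natrD; set t := angle _ _ _.
  by rewrite (mulrBl t) (mulrDl _ _ t) cosB cosD; field.
rewrite [X in _ - X]sum_cos; last by lia.
have [->|jl] := eqVneq j l.
  rewrite subnn; under eq_bigr do rewrite mul0r cos0.
  rewrite sumr_const card_ord addnn -mul2n exprM sqrrN expr1n expr1n mul1r -natr1.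
  by field.
rewrite sum_cos; last by lia.
have -> : (-1) ^+ (j + l) = (-1) ^+ (j - l) :> R.
  by rewrite -signr_odd oddD -oddB // signr_odd.
by rewrite subrr !mul0r.
Qed.

Variables (lam : R).
Hypothesis lam_gt0 : 0 < lam.
Let r := Num.sqrt lam.

Let r0 : r != 0. Proof. by rewrite gt_eqF // sqrtr_gt0. Qed.
Let r2 : r ^+ 2 = lam. Proof. by rewrite sqr_sqrtr // ltW. Qed.

(** The addition formulas turn the three-term recurrence into one for [sin (j%:R * t)]. The product
    form also covers zeros of the sine. *)
Lemma orthopoly_cos j (t : R) :
  orthopoly lam j (2 * r * cos t + lam + 1) * (r * sin t) = r ^+ j * sin (j%:R * t).
Proof.
elim/ltn_ind: j => -[|[|j]] IH.
- by rewrite orthopoly0 !mul0r sin0 mulr0.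
- by rewrite orthopoly1 !mul1r.
rewrite orthopolySS mulrBl.
rewrite -(mulrA _ (orthopoly _ j.+1 _)) -(mulrA _ (orthopoly _ j _)) !IH //.
set a := j.+1%:R * t.
have -> : j%:R * t = a - t by rewrite /a -natr1; ring.
have -> : j.+2%:R * t = a + t by rewrite /a -natr1; ring.
by rewrite sinB sinD -r2 !exprS; ring.
Qed.

(* The paper's [y_(m,k)] for [k >= 1], with [k] shifted by one. *)
Definition gauss_node m (k : 'I_m) : R := atom m lam k.+1.
(** Gauss weights for the Chebyshev weight of the second kind, normalised to total mass 1. Shifting
    and scaling the nodes does not affect them, so [lam] is absent. *)
Definition gauss_weight m (k : 'I_m) : R := 2 * sin (angle R m k.+1) ^+ 2 / m.+1%:R.

Let ang m (k : 'I_m) := angle_bounds (ltn_ord k : (0 < k.+1 <= m)%N).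

Lemma orthopoly_node m j (k : 'I_m) :
  orthopoly lam j (gauss_node k) =
  r ^+ j * sin (j%:R * angle R m k.+1) / (r * sin (angle R m k.+1)).
Proof.
rewrite -orthopoly_cos mulfK // mulf_neq0 //.
by rewrite gt_eqF // sin_gt0_pi // ang.
Qed.

Lemma orthopoly_root m (k : 'I_m) : orthopoly lam m.+1 (gauss_node k) = 0.
Proof.
rewrite orthopoly_node /angle.
have -> : m.+1%:R * (k.+1%:R * pi / m.+1%:R) = k.+1%:R * pi :> R.
  by field; rewrite nat1r pnatr_eq0.
by rewrite sin_nat_pi mulr0 mul0r.
Qed.

(** As [m] times the angle is a multiple of [pi] minus the angle, the two sines in [orthopoly_node]
    cancel up to sign. *)
Lemma orthopoly_node_sqr m (k : 'I_m) : orthopoly lam m (gauss_node k) ^+ 2 = lam ^+ m.-1.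
Proof.
have sk : sin (angle R m k.+1) != 0 by rewrite gt_eqF // sin_gt0_pi // ang.
have m0 : (0 < m)%N := leq_ltn_trans (leq0n k) (ltn_ord k).
rewrite orthopoly_node.
have -> : m%:R * angle R m k.+1 = k.+1%:R * pi - angle R m k.+1.
  by rewrite /angle -[m.+1%:R]natr1; field; rewrite natr1 pnatr_eq0.
rewrite sinB cos_nat_pi sin_nat_pi mul0r sub0r.
rewrite -{1}(prednK m0) [r ^+ _]exprS -r2.
transitivity (((-1) ^+ k.+1) ^+ 2 * (r ^+ m.-1) ^+ 2).
  by field; rewrite r0 sk.
by rewrite sqrr_sign mul1r -!exprM mulnC.
Qed.

(** The squared sine in the weight cancels the denominators from [orthopoly_node], which leaves
    [sin_orthogonal]. *)
Lemma gauss_orthogonal m j : (j < m)%N ->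
  \sum_(k < m) gauss_weight k * orthopoly lam j.+1 (gauss_node k) *
    orthopoly lam m (gauss_node k) = (j == m.-1)%:R * lam ^+ m.-1.
Proof.
case: m => // m jm.
transitivity (r ^+ (j + m) * (2 / m.+2%:R) *
  \sum_(k < m.+1) sin (j.+1%:R * angle R m.+1 k.+1) * sin (m.+1%:R * angle R m.+1 k.+1)).
  rewrite mulr_sumr; apply: eq_bigr => k _; rewrite !orthopoly_node /gauss_weight.
  have sk : sin (angle R m.+1 k.+1) != 0 by rewrite gt_eqF // sin_gt0_pi // ang.
  rewrite exprD !exprS; set s := sin (angle _ _ _); field.
  by rewrite -natrD pnatr_eq0 r0 sk.
rewrite sin_orthogonal ?ltnS ?leqnn // eqSS /=.
have [->|_] := eqVneq j m; last by rewrite !mul0r mulr0.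
rewrite addnn -mul2n exprM r2; field.
by rewrite -natrD pnatr_eq0.
Qed.

Lemma gauss_partial_fraction m x : orthopoly lam m.+1 x != 0 ->
  \sum_(k < m) gauss_weight k / (x - gauss_node k) =
  orthopoly lam m x / orthopoly lam m.+1 x.
Proof.
apply: partial_fraction; first by rewrite gt_eqF.
- exact: orthopoly_root.
- exact: orthopoly_node_sqr.
- exact: gauss_orthogonal.
Qed.

Lemma gauss_quad_rec m n :
  quad gauss_node gauss_weight m.+1 n.+1 =
  (1 + lam) * quad gauss_node gauss_weight m.+1 n +
  lam * \sum_(i < n) quad gauss_node gauss_weight m i *
                     quad gauss_node gauss_weight m.+1 (n - i.+1)%N.
Proof.
apply: quad_rec; first by rewrite gt_eqF.
- exact: orthopoly_root.
- exact: gauss_partial_fraction.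
Qed.

Lemma gauss_quad0 m : quad gauss_node gauss_weight m.+1 0 = 1.
Proof.
have := @sin_orthogonal m.+1 1 1 isT isT; rewrite eqxx mul1r => h.
rewrite /quad; under eq_bigr do rewrite expr0 mulr1 /gauss_weight -[X in sin X]mul1r expr2.
rewrite -mulr_suml -mulr_sumr h; field.
by rewrite -natrD pnatr_eq0.
Qed.

(** With c the cosine, the node is (r - 1)^2 + 2 r (1 + c), and c exceeds -1 because the angle lies
    strictly between 0 and [pi]. *)
Lemma gauss_node_gt0 m (k : 'I_m) : 0 < gauss_node k.
Proof.
have /andP[a0 api] := ang k.
have sk : sin (angle R m k.+1) != 0 by rewrite gt_eqF // sin_gt0_pi // ang.
have cN1 : - 1 < cos (angle R m k.+1).
  rewrite lt_neqAle cos_geN1 andbT; apply: contraNneq sk => e.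
  by rewrite -norm_cos_eq1 -e normrN normr1.
have rp : 0 < r by rewrite sqrtr_gt0.
have : 0 < r * (1 + cos (angle R m k.+1)) by rewrite mulr_gt0 //; lra.
rewrite /gauss_node /= -/r -[X in _ + X + 1]r2.
by have := sqr_ge0 (r - 1); nra.
Qed.

End Nodes.

(** * The atom at 0 and the total mass *)

Section Weights.
Variables (R : realType) (lam : R).
Hypothesis lam_gt0 : 0 < lam.
Let r := Num.sqrt lam.

Let r0 : r != 0. Proof. by rewrite gt_eqF // sqrtr_gt0. Qed.
Let r2 : r ^+ 2 = lam. Proof. by rewrite sqr_sqrtr // ltW. Qed.

(** The sum, unlike the closed form of the geometric series, also covers [lam = 1]. *)
Definition geom j : R := \sum_(i < j) lam ^+ i.

Lemma geomS j : geom j.+1 = lam * geom j + 1.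
Proof.
rewrite /geom big_ord_recl expr0 addrC mulr_sumr; congr (_ + _).
by apply: eq_bigr => i _; rewrite -exprS.
Qed.

Lemma geom_gt0 j : 0 < geom j.+1.
Proof.
elim: j => [|j IH]; first by rewrite geomS /geom big_ord0 mulr0 add0r.
by rewrite geomS addr_gt0 // mulr_gt0.
Qed.

Lemma geom_SS j : geom j.+2 = (lam + 1) * geom j.+1 - lam * geom j.
Proof. by rewrite geomS [geom j.+1]geomS; ring. Qed.

Lemma chebyshevUSS (x : R) j :
  chebyshevU j.+2 x = 2 * x * chebyshevU j.+1 x - chebyshevU j x.
Proof. by []. Qed.

(** After scaling by [r ^+ j], the Chebyshev recurrence at this point has characteristic roots 1 and
    [lam], as in [geom_SS]. *)
Lemma chebyshevU_geom j : chebyshevU j ((lam + 1) / (2 * r)) * r ^+ j = geom j.+1.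
Proof.
elim/ltn_ind: j => -[|[|j]] IH.
- by rewrite geomS /geom big_ord0 /= mulr0 add0r mulr1.
- rewrite !geomS /geom big_ord0 /= mulr0 add0r mulr1; field; exact: r0.
set X := (lam + 1) / _.
have -> : chebyshevU j.+2 X * r ^+ j.+2 =
    2 * X * r * (chebyshevU j.+1 X * r ^+ j.+1) - r ^+ 2 * (chebyshevU j X * r ^+ j).
  by rewrite chebyshevUSS !exprS; ring.
rewrite !IH // r2 [RHS]geom_SS; congr (_ * _ - _).
by rewrite /X; field; exact: r0.
Qed.

(** The powers of [r] cancel to [geom m.+2 / geom m.+1 - lam], whose numerator is 1 by [geomS]. *)
Lemma weight0 m : weight m lam 0 = 1 / geom m.+1.
Proof.
have rn j : r ^+ j != 0 by rewrite expf_neq0.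
have UE j : chebyshevU j ((lam + 1) / (2 * r)) = geom j.+1 / r ^+ j.
  by rewrite -chebyshevU_geom mulfK.
rewrite /weight -/r !UE [geom m.+2]geomS exprS.
by field; rewrite r0 rn gt_eqF // geom_gt0.
Qed.

(** Dividing by the node turns the moment of order [n.+1] into [lam] times the Gauss moment of order
    [n]. *)
Lemma weightS m (k : 'I_m) :
  weight m lam k.+1 = lam * gauss_weight R k / gauss_node lam k.
Proof.
rewrite /weight /gauss_weight /gauss_node /atom; set v := _ + lam + 1.
have v0 : v != 0 by rewrite gt_eqF //; exact: (gauss_node_gt0 lam_gt0 k).
by field; rewrite v0 nat1r pnatr_eq0.
Qed.

Lemma weight_ge0 m k : (k <= m)%N -> 0 <= weight m lam k.
Proof.
case: k => [_|k km]; first by rewrite weight0 divr_ge0 // ltW // geom_gt0.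
rewrite (weightS (Ordinal km)) divr_ge0 ?(ltW (gauss_node_gt0 lam_gt0 _)) //.
by rewrite mulr_ge0 ?(ltW lam_gt0) // divr_ge0 // mulr_ge0 // sqr_ge0.
Qed.

Lemma orthopoly_at0 j : orthopoly lam j 0 = - (-1) ^+ j * geom j.
Proof.
elim/ltn_ind: j => -[|[|j]] IH.
- by rewrite orthopoly0 /geom big_ord0 mulr0.
- by rewrite orthopoly1 geomS /geom big_ord0; ring.
by rewrite orthopolySS !IH // geom_SS !exprS; ring.
Qed.

(** The partial fraction identity at [x = 0] gives the positive atoms the mass
    [lam * geom m / geom m.+1]; by [geomS], [weight0] is exactly what is missing. *)
Lemma sum_weights m :
  \sum_(k < m.+1) weight m lam k = 1.
Proof.
rewrite big_ord_recl weight0.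
have g0 : geom m.+1 != 0 by rewrite gt_eqF // geom_gt0.
have s0 : (-1) ^+ m.+1 != 0 :> R by rewrite signr_eq0.
have o0 : orthopoly lam m.+1 0 != 0.
  by rewrite orthopoly_at0 mulf_neq0 // oppr_eq0.
have := gauss_partial_fraction lam_gt0 o0.
rewrite !orthopoly_at0 => h.
have -> : \sum_(i < m) weight m lam (lift ord0 i) =
    - lam * \sum_(k < m) gauss_weight R k / (0 - gauss_node lam k).
  rewrite mulr_sumr; apply: eq_bigr => k _; rewrite lift0 weightS.
  have v0 : gauss_node lam k != 0 by rewrite gt_eqF // gauss_node_gt0.
  by field; rewrite ?oppr_eq0 ?v0.
rewrite h; move: g0; rewrite geomS exprS => g0; field.
by rewrite signr_eq0 g0.
Qed.

(** The atom at 0 contributes only to the moment of order 0. *)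
Lemma sum_weights_moment m n :
  \sum_(k < m.+1) weight m lam k * atom m lam k ^+ n =
  NC_of_seq lam (quad (gauss_node lam) (gauss_weight R)) m n.
Proof.
case: n => [|n].
  by under eq_bigr do rewrite expr0 mulr1; rewrite sum_weights.
rewrite big_ord_recl expr0n mulr0 add0r /NC_of_seq /quad mulr_sumr.
apply: eq_bigr => k _; rewrite lift0 -/(gauss_node lam k) weightS exprS.
have v0 : gauss_node lam k != 0 by rewrite gt_eqF // gauss_node_gt0.
by field.
Qed.

End Weights.

(** * Measures with finite support *)

(** Newton's scheme: a new node is corrected by a multiple of the polynomial that vanishes at the
    earlier ones. Repetitions in [s] are allowed, so atoms need not be shown distinct. *)
Lemma interpolation (F : fieldType) (s : seq F) (f : F -> F) :
  exists p : {poly F}, {in s, forall y, p.[y] = f y}.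
Proof.
elim: s => [|y s [p ps]]; first by exists 0.
have [ys|ys] := boolP (y \in s).
  by exists p => z; rewrite inE => /predU1P[->|]; exact: ps.
set q := \prod_(z <- s) ('X - z%:P).
have qy : q.[y] != 0 by rewrite -rootE root_prod_XsubC.
exists (p + ((f y - p.[y]) / q.[y]) *: q) => z.
rewrite inE hornerD hornerZ => /predU1P[->|zs]; first by rewrite divfK // addrC subrK.
have /rootP -> : root q z by rewrite root_prod_XsubC.
by rewrite mulr0 addr0 ps.
Qed.

Section PointMeasure.
Variables (R : realType) (N : nat) (w : nat -> {nonneg R}) (y : nat -> R).

Definition point_measure : {measure set (measurableTypeR R) -> \bar R} :=
  msum (fun k => mscale (w k) (dirac (y k : measurableTypeR R))) N.

Lemma point_measureE (A : set (measurableTypeR R)) :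
  point_measure A = (\sum_(k < N) ((w k)%:num)%:E * \d_(y k) A)%E.
Proof. by []. Qed.

Lemma ge0_integral_point_measure (f : measurableTypeR R -> \bar R) :
  measurable_fun [set: measurableTypeR R] f -> (forall x, 0 <= f x)%E ->
  (\int[point_measure]_(x in [set: R]) f x = \sum_(k < N) ((w k)%:num)%:E * f (y k))%E.
Proof.
move=> mf f0; rewrite ge0_integral_measure_sum //; apply: eq_bigr => k _.
by rewrite ge0_integral_mscale //= integral_dirac //= diracT mul1e.
Qed.

Lemma integral_point_measure (f : measurableTypeR R -> R) :
  measurable_fun [set: measurableTypeR R] f ->
  point_measure.-integrable [set: R] (EFin \o f) /\
  (\int[point_measure]_(x in [set: R]) (f x)%:E =
    (\sum_(k < N) (w k)%:num * f (y k))%:E)%E.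
Proof.
move=> mf; have mfE : measurable_fun [set: measurableTypeR R] (EFin \o f).
  exact/measurable_EFinP.
split.
  apply/integrableP; split=> //.
  rewrite ge0_integral_point_measure //; last exact: measurableT_comp.
  by under eq_bigr do rewrite /= -EFinM; rewrite sumEFin ltry.
rewrite integralE !ge0_integral_point_measure //;
  [|exact: measurable_funeneg|exact: measurable_funepos].
under eq_bigr do rewrite funeposE /= -EFin_max -EFinM.
under [X in (_ - X)%E]eq_bigr do rewrite funenegE /= -EFin_max -EFinM.
rewrite !sumEFin -EFinB -sumrB; congr (_%:E); apply: eq_bigr => k _.
rewrite -mulrBr; congr (_ * _); have [h|/ltW h] := leP 0 (f (y k)).
  by rewrite (max_idPr _) ?oppr_le0 // subr0.
by rewrite (max_idPl _) ?oppr_ge0 // sub0r opprK.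
Qed.

End PointMeasure.

(** * Uniqueness from the moments *)

Section Determinacy.
Variables (R : realType) (N : nat) (w y : nat -> R).
Variable nu : {measure set (measurableTypeR R) -> \bar R}.
Hypothesis nuM : has_moments nu (fun n => \sum_(k < N) w k * y k ^+ n).

Lemma integral_horner (p : {poly R}) :
  nu.-integrable [set: R] (fun x : measurableTypeR R => (p.[x : R])%:E) /\
  (\int[nu]_(x in [set: R]) (p.[x : R])%:E = (\sum_(k < N) w k * p.[y k])%:E)%E.
Proof.
have hE : (fun x : measurableTypeR R => (p.[x : R])%:E) =
    (fun x => (\sum_(i < size p) (p`_i)%:E * ((x : R) ^+ i)%:E)%E).
  by apply/funext => x; rewrite horner_coef -sumEFin.
rewrite hE; split.
  by apply: integrable_sum => // i _; apply: integrableZl => //; have [] := nuM i.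
rewrite integral_sum // => [|i]; last by apply: integrableZl => //; have [] := nuM i.
transitivity (\sum_(i < size p) (p`_i * \sum_(k < N) w k * y k ^+ i)%:E)%E.
  by apply: eq_bigr => i _; have [h1 h2] := nuM i; rewrite integralZl // h2 EFinM.
rewrite sumEFin; congr (_%:E).
under eq_bigr do rewrite mulr_sumr.
rewrite exchange_big /=; apply: eq_bigr => k _; rewrite horner_coef mulr_sumr.
by apply: eq_bigr => i _; rewrite mulrCA.
Qed.

Lemma point_measure_unique (A : set (measurableTypeR R)) : measurable A ->
  nu A = (\sum_(k < N) (w k)%:E * \d_(y k) A)%E.
Proof.
move=> mA.
pose s := [seq y k | k <- iota 0 N].
have ys (k : 'I_N) : y k \in s by apply: map_f; rewrite mem_iota ltn_ord.
pose P : {poly R} := \prod_(z <- s) ('X - z%:P).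
(* [P] vanishes at all nodes, so its square integrates to 0 and [nu]-almost every point is a
   node. *)
have [intP IP] := integral_horner (P ^+ 2).
have P0 : (\int[nu]_(x in [set: R]) `| ((P ^+ 2).[x : R])%:E | = 0)%E.
  under eq_integral => x _ do rewrite gee0_abs ?lee_fin ?horner_exp ?sqr_ge0 // -horner_exp.
  rewrite IP big1 // => k _; rewrite horner_exp.
  have /rootP -> : root P (y k) by rewrite root_prod_XsubC.
  by rewrite expr0n mulr0.
have {P0} := (ae_eq_integral_abs nu measurableT (measurable_int _ intP)).1 P0 => aeP.
(* On the nodes, hence [nu]-almost everywhere, the indicator of [A] is a polynomial, whose integral
   the moments determine. *)
have [p ps] := interpolation s (\1_A : R -> R).
have [intp Ip] := integral_horner p.
have -> : nu A = (\int[nu]_(x in [set: R]) (\1_A x)%:E)%E.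
  by rewrite integral_indic // setIT.
rewrite (@ae_eq_integral _ _ _ nu [set: R] (fun x => (p.[x : R])%:E)) //; last 1 first.
- apply: filterS aeP => x /(_ I) /=; move=> [] /eqP; rewrite horner_exp sqrf_eq0 => h _.
  by rewrite ps // -root_prod_XsubC.
- by rewrite Ip -sumEFin; apply: eq_bigr => k _; rewrite EFinM ps.
- exact/measurable_EFinP/measurable_indic.
- exact: measurable_int intp.
Qed.

End Determinacy.

Theorem theorem6p4 (R : realType) (m : nat) (lam : R)
    (hm : (1 <= m)%N) (hlam : 0 < lam) :
  exists mu : {measure set (measurableTypeR R) -> \bar R},
    [/\ has_moments mu (NC_moment m lam),
        forall nu : {measure set (measurableTypeR R) -> \bar R},
          has_moments nu (NC_moment m lam) ->
          forall A : set (measurableTypeR R), measurable A -> nu A = mu A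
      & forall A : set (measurableTypeR R), measurable A ->
          mu A = (\sum_(k < m.+1)
                    (weight m lam k)%:E * \d_(atom m lam k) A)%E].
Proof.
have momentE : NC_moment m lam =
    fun n => \sum_(k < m.+1) weight m lam k * atom m lam k ^+ n.
  apply/funext => n; rewrite sum_weights_moment //; case: n => [//|n].
  rewrite /NC_moment NCsum_card //.
  rewrite (@NCsum_eq _ _ (quad (gauss_node lam) (gauss_weight R))) ?leqnn // => [k|m'|m' k].
  - by rewrite /quad big_ord0.
  - exact: gauss_quad0.
  - exact: gauss_quad_rec.
(* The norm only packages the weights as nonnegative numbers for every index; up to [m] it changes
   nothing, by [weight_ge0]. *)
pose w (k : nat) := NngNum (normr_ge0 (weight m lam k)).
have wE (k : 'I_m.+1) : (w k)%:num = weight m lam k.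
  by rewrite /= ger0_norm // weight_ge0 // -ltnS.
pose mu : {measure set (measurableTypeR R) -> \bar R} :=
  point_measure m.+1 w (atom m lam).
have muE A : mu A = (\sum_(k < m.+1) (weight m lam k)%:E * \d_(atom m lam k) A)%E.
  by rewrite [LHS]point_measureE; apply: eq_bigr => k _; rewrite wE.
exists mu; split=> [|nu|//]; rewrite momentE.
  move=> n; have [intn In] := integral_point_measure m.+1 w (atom m lam)
    (exprn_measurable n).
  by split=> //; rewrite In; congr (_%:E); apply: eq_bigr => k _; rewrite wE.
by move=> nuM A mA; rewrite (point_measure_unique nuM mA) muE.
Qed.
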